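(* Let $p$ be a prime, let $n\ge 3$, let $l,c$ be positive integers with $l+c<n$, and let $r,s$ be powers of $p$ with non-negative integer exponents such that $r>1$ or $s>1$. Let $X=X[r,s]_l^c$ be the Frobenius incidence variety. There exists a polynomial $N(t)$ with integer coefficients such that, for every integer $\nu\ge 1$, the number of $\mathbb{F}_{(rs)^\nu}$-rational points of $X$ is equal to $N((rs)^\nu)$.
   Context: Fix an $n$-dimensional vector space $V$ over $\mathbb{F}_p$. $G_{n,l}=G_n^{n-l}$ denotes the Grassmannian of $l$-dimensional subspaces of $V$ (so $G_n^c$ parametrizes subspaces of codimension $c$), viewed as a scheme over $\mathbb{F}_p$. Let $\mathcal{I}\subset G_{n,l}\times G_n^c$ be the incidence subvariety, i.e. the reduced subscheme with $\mathcal{I}(F)=\{(L,M): L\subset M\}$ for every field $F$ of characteristic $p$. For a power $q=p^\nu$ with $\nu\geq 1$, $\phi^{(q)}$ denotes the $q$-th power Frobenius morphism of a Grassmannian, and $\phi^{(1)}=\mathrm{id}$. For $L\in G_{n,l}(F)$, $L^q$ denotes its image under $\phi^{(q)}$ (if $L$ is defined by $\sum_j a_{ij}x_j=0$ in $\mathbb{F}_p$-rational coordinates, $L^q$ is defined by $\sum_j a_{ij}^q x_j=0$). The Frobenius incidence variety is the scheme-theoretic intersection $$X[r,s]_l^c:=(\phi^{(r)}\times\mathrm{id})^*\mathcal{I}\,\cap\,(\mathrm{id}\times\phi^{(s)})^*\mathcal{I}\subset G_{n,l}\times G_n^c,$$ a scheme over $\mathbb{F}_p$; for any field $F\supset\mathbb{F}_p$,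 $X(F)=\{(L,M)\in G_{n,l}(F)\times G_n^c(F): L^r\subset M \text{ and } L\subset M^s\}$. *)

(* Defs.v *)
From HB Require Import structures.
From mathcomp Require Import all_boot all_order all_algebra all_field.

Set Implicit Arguments.
Unset Strict Implicit.
Unset Printing Implicit Defensive.

Import GRing.Theory.
Local Open Scope ring_scope.

(* V = F_p^n, so that the base change of V to F is 'rV[F]_n and its standard
   coordinates are F_p-rational.  Points over F of the Grassmannians of V are
   subspaces of 'rV[F]_n. *)

Section FinVspace.
Variables (F : finFieldType) (n : nat).

Fact vspace_set_can :
  cancel (fun L : {vspace 'rV[F]_n} => [set x | x \in L])
         (fun S : {set 'rV[F]_n} => <<enum S>>%VS).
Proof.
move=> L; apply/eqP; rewrite eqEsubv; apply/andP; split.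
  by apply/span_subvP=> x; rewrite mem_enum inE.
by apply/subvP=> x Lx; rewrite memv_span // mem_enum inE.
Qed.

HB.instance Definition _ : isCountable {vspace 'rV[F]_n} :=
  CanIsCountable vspace_set_can.
HB.instance Definition _ : isFinite {vspace 'rV[F]_n} :=
  CanIsFinite vspace_set_can.

End FinVspace.

Section FrobeniusIncidence.
Variables (F : fieldType) (n : nat).
Implicit Types L M : {vspace 'rV[F]_n}.

Definition grass (l : nat) : pred {vspace 'rV[F]_n} :=
  [pred L | \dim L == l].

Definition cograss (c : nat) : pred {vspace 'rV[F]_n} :=
  [pred M | (\dim M + c)%N == n].

Definition incident : pred ({vspace 'rV[F]_n} * {vspace 'rV[F]_n}) :=
  [pred LM | (LM.1 <= LM.2)%VS].

(* The space of x such that \sum_j x_j A_{ji} = 0 for every i: the columns of A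
   are the equations. *)
Definition solutions (m : nat) (A : 'M[F]_(n, m)) : {vspace 'rV[F]_n} :=
  lker (linfun (mulmxr A)).

(* One system of equations of L (see solutions_equations), namely
   x - projv L x = 0; for q a power of the characteristic, frobV q does not
   depend on this choice (see frobV_solutions). *)
Definition equations L : 'M[F]_n := lin1_mx (fun x => x - projv L x).

Definition frobV (q : nat) L : {vspace 'rV[F]_n} :=
  solutions (map_mx (fun a => a ^+ q) (equations L)).

Definition frob_incidence (r s l c : nat) :
    pred ({vspace 'rV[F]_n} * {vspace 'rV[F]_n}) :=
  [pred LM | [&& LM.1 \in grass l, LM.2 \in cograss c,
                 (frobV r LM.1, LM.2) \in incident
               & (LM.1, frobV s LM.2) \in incident]].

Lemma mem_solutions m (A : 'M[F]_(n, m)) (x : 'rV[F]_n) :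
  (x \in solutions A) = (x *m A == 0).
Proof. by rewrite memv_ker lfunE. Qed.

Lemma solutions_equations L : solutions (equations L) = L.
Proof.
apply/vspaceP=> x; rewrite mem_solutions.
have ->: x *m equations L = x - projv L x.
  pose f : {linear 'rV[F]_n -> 'rV[F]_n} := (\1 - projv L)%VF.
  have fE y : f y = y - projv L y by rewrite /f /= !lfunE /= opp_lfunE id_lfunE.
  rewrite -fE -mul_rV_lin1; congr (_ *m _).
  by apply/matrixP=> i j; rewrite [LHS]mxE [RHS]mxE fE.
rewrite subr_eq0; apply/eqP/idP => [->|/projv_id //]; exact: memv_proj.
Qed.

Lemma dim_solutions m (A : 'M[F]_(n, m)) :
  \dim (solutions A) = (n - \rank A)%N.
Proof.
rewrite -mxrank_ker; set K := row_base (kermx A).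
have sumK (u : 'rV_(\rank (kermx A))) : \sum_i u 0 i *: row i K = u *m K.
  by rewrite mulmx_sum_row.
pose X := [tuple row i K | i < \rank (kermx A)].
have XE (i : 'I_(\rank (kermx A))) : X`_i = row i K.
  by rewrite (nth_map i) ?size_enum_ord // nth_ord_enum.
suff /size_basis -> : basis_of (solutions A) X by [].
apply/andP; split; last first.
- apply/freeP=> k /=; under eq_bigr => i _ do rewrite XE.
  move=> k0 i; pose u := \row_i k i.
  have: u *m K = 0.
    by rewrite -sumK -[RHS]k0; apply: eq_bigr => j _; rewrite mxE.
  rewrite -(mul0mx _ K) => /(row_free_inj (row_base_free _)) /rowP/(_ i).
  by rewrite !mxE.
- rewrite eqEsubv; apply/andP; split.
    apply/span_subvP=> x /tnthP[i ->]; rewrite tnth_mktuple mem_solutions.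
    apply/eqP/sub_kermxP; rewrite (submx_trans (row_sub _ _)) //.
    by rewrite eq_row_base.
  apply/subvP=> x; rewrite mem_solutions => /eqP/sub_kermxP.
  rewrite -(eq_row_base (kermx A)) => /submxP[u ->]; rewrite -sumK.
  apply: rpred_sum => i _; apply/rpredZ/memv_span.
  by apply/tnthP; exists i; rewrite tnth_mktuple.
Qed.

Section CharPower.
Variable q : nat.
Hypothesis pchar_q : [pchar F].-nat q.

Let pow_q (a : F) := a ^+ q.

Let pow_q_zmod : zmod_morphism pow_q.
Proof.
move=> a b; rewrite /pow_q exprDn_pchar //; congr (_ + _).
have := exprDn_pchar b (- b) pchar_q.
rewrite subrr expr0n; case: q pchar_q => [|q'] //= _ /eqP.
by rewrite eq_sym addrC addr_eq0 => /eqP.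
Qed.

Let pow_q_monoid : monoid_morphism pow_q.
Proof. by split=> [|a b]; rewrite /pow_q ?expr1n ?exprMn. Qed.

Let phi : {rmorphism F -> F} := HB.pack pow_q
  (GRing.isZmodMorphism.Build F F pow_q pow_q_zmod)
  (GRing.isMonoidMorphism.Build F F pow_q pow_q_monoid).

Lemma frobV_solutions m (A : 'M[F]_(n, m)) :
  frobV q (solutions A) = solutions (map_mx (fun a => a ^+ q) A).
Proof.
have sub m1 m2 (B : 'M[F]_(n, m1)) (C : 'M[F]_(n, m2)) :
    (solutions B <= solutions C)%VS ->
    (solutions (map_mx phi B) <= solutions (map_mx phi C))%VS.
  move/subvP=> BC.
  have [D ->]: exists D, C = B *m D.
    suff: (C^T <= B^T)%MS.
      by case/submxP=> D /(congr1 trmx); rewrite trmx_mul !trmxK => ->; exists D^T.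
    rewrite submxE.
    have K0: (cokermx B^T)^T *m B = 0.
      by apply: trmx_inj; rewrite trmx_mul trmxK mulmx_coker trmx0.
    suff K1: (cokermx B^T)^T *m C = 0.
      by apply/eqP/trmx_inj; rewrite trmx_mul trmxK K1 trmx0.
    apply/row_matrixP=> i; rewrite row_mul row0; apply/eqP.
    by rewrite -mem_solutions BC // mem_solutions -row_mul K0 row0.
  apply/subvP=> x; rewrite !mem_solutions => /eqP x0.
  by rewrite map_mxM mulmxA x0 mul0mx.
apply/eqP; rewrite eqEsubv.
by apply/andP; split; apply: sub; rewrite solutions_equations subvv.
Qed.

Lemma mem_frobV L (x : 'rV[F]_n) :
  (map_mx (fun a => a ^+ q) x \in frobV q L) = (x \in L).
Proof.
rewrite -[in RHS](solutions_equations L) !mem_solutions.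
by rewrite -(map_mxM phi) (map_mx_eq0 phi).
Qed.

Lemma dim_frobV L : \dim (frobV q L) = \dim L.
Proof.
rewrite -[in RHS](solutions_equations L) !dim_solutions.
by rewrite (mxrank_map phi).
Qed.

End CharPower.

Lemma frobV1 L : frobV 1 L = L.
Proof.
rewrite -[RHS]solutions_equations /frobV; congr solutions.
by apply/matrixP=> i j; rewrite mxE.
Qed.

End FrobeniusIncidence.

(* Main.v *)
From HB Require Import structures.
Require Import Defs.
From mathcomp Require Import all_boot all_order all_algebra all_field.
From mathcomp Require Import ring zify.

(** Write [q = r * s], let [Q] be the cardinal of [F], a power of [q], and let
    [phi] be the [q]-Frobenius on the subspaces of [F^n].  Since the
    [s]-Frobenius permutes the subspaces of each dimension and reflects
    inclusion, replacing [M] by its image [M'] turns the two incidence conditions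
    into [phi L <= M'] and [L <= M'].  Over a given [L], the number of solutions
    [M'] is thus a Gaussian binomial in [Q] that depends only on the dimension of
    [L + phi L], or equivalently on that of [L :&: phi L].

    So let [N(l, i)] be the number of [l]-dimensional [L] such that
    [L :&: phi L] has dimension [i]; it suffices that each [N(l, i)] is an
    integral polynomial in [Q].  Counting the pairs [K <= L] with
    [K <= L :&: phi L], [\dim K = i] and [\dim L = l] either by [L], or by the
    subspace [K'] with [K = phi K'], for which [L] has to contain [K' + phi K'],
    gives ([cap_count_double])
<<
      \sum_(k <= l) N(l, k) [k choose i]_Q
        = \sum_(k <= i) N(i, k) [n - (2 i - k) choose l - (2 i - k)]_Q
>>
    For [i < l] the right-hand side is known by induction on [l], and on the left
    the coefficient of [N(l, i)] is 1 while the terms with [k < i] vanish: the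
    numbers [N(l, i)] are computed from [N(l, l)] downwards, without division
    ([polynomial_cap_count]).

    Finally [N(l, l)] is the number of [phi]-stable subspaces.  These descend to
    the subfield of [q] elements fixed by the Frobenius, so that [N(l, l)] is the
    value at [q] of a Gaussian binomial: a constant, the same for all the fields
    [F] considered ([card_stable_subspaces]). *)

Set Implicit Arguments.
Unset Strict Implicit.
Unset Printing Implicit Defensive.

Import Order.TTheory GRing.Theory Num.Theory.
Local Open Scope ring_scope.

(** * Gaussian binomial polynomials *)

Fixpoint gauss (n k : nat) : {poly int} :=
  match n, k with
  | _, 0 => 1
  | 0, _.+1 => 0
  | n'.+1, k'.+1 => gauss n' k' + 'X^k * gauss n' k
  end.

Lemma gaussn0 n : gauss n 0 = 1.
Proof. by case: n. Qed.

Lemma gauss_small n k : (n < k)%N -> gauss n k = 0.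
Proof.
elim: n k => [|n IHn] [|k] //= nk.
by rewrite !IHn ?mulr0 ?addr0 // ltnW.
Qed.

Lemma gaussnn n : gauss n n = 1.
Proof. by elim: n => //= n ->; rewrite gauss_small ?mulr0 ?addr0. Qed.

(** Two ways of clearing the denominators of a Gaussian binomial.  Neither is
    inductive alone: the Pascal rule for one of them produces the other one in
    the preceding row. *)
Lemma gauss_absorb_pair n k :
  ('X^(k.+1) - 1) * gauss n.+1 k.+1 = ('X^(n.+1) - 1) * gauss n k
  /\ ((k <= n)%N -> ('X^(n.+1 - k) - 1) * gauss n.+1 k
                    = ('X^(n.+1) - 1) * gauss n k).
Proof.
elim: n k => [|n IHn] k.
  case: k => [|k] /=; last by rewrite mulr0 addr0 !mulr0.
  by rewrite mulr0 addr0.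
have low j : (j <= n.+1)%N ->
    ('X^(n.+2 - j) - 1) * gauss n.+2 j = ('X^(n.+2) - 1) * gauss n.+1 j.
  case: j => [|j] jn; first by rewrite !gaussn0.
  have -> : (n.+2 - j.+1)%N = (n.+1 - j)%N by [].
  rewrite [gauss n.+2 _]/= -/(gauss n.+1 j.+1) -/(gauss n.+1 j).
  rewrite mulrDr (proj2 (IHn j) jn) -(proj1 (IHn j)).
  have -> : 'X^(n.+2) = 'X^(n.+1 - j) * 'X^(j.+1) :> {poly int}.
    by rewrite -exprD; congr ('X^_); lia.
  by ring.
split=> [|kn]; last exact: low.
rewrite [gauss n.+2 _]/= -/(gauss n.+1 k.+1) -/(gauss n.+1 k).
rewrite mulrDr mulrCA (proj1 (IHn k)).
have [kn|nk] := leqP k n; last first.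
  have [->|kn] := eqVneq k n.+1.
    by rewrite gaussnn gauss_small // !mulr0 addr0.
  by rewrite !gauss_small ?mulr0 ?addr0 //; lia.
rewrite -(proj2 (IHn k) kn).
have -> : 'X^(n.+2) = 'X^(n.+1 - k) * 'X^(k.+1) :> {poly int}.
  by rewrite -exprD; congr ('X^_); lia.
by ring.
Qed.

Lemma gauss_absorb n k :
  ('X^(k.+1) - 1) * gauss n.+1 k.+1 = ('X^(n.+1) - 1) * gauss n k.
Proof. by have [] := gauss_absorb_pair n k. Qed.

(** * Counting subspaces of a space over a finite field *)

Section CountSubspaces.
Variables (F : finFieldType) (n : nat).
Implicit Types A J K L : {vspace 'rV[F]_n}.

(** A complement [C] of [A] in [J] identifies the subspaces of [C] with those
    between [A] and [J], by [K |-> K + A] and [K |-> K :&: C]. *)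
Lemma card_sup_subspaces A J k : (A <= J)%VS ->
  #|[set K | [&& (A <= K)%VS, (K <= J)%VS & \dim K == (\dim A + k)%N]]|
  = #|[set K | (K <= J :\: A)%VS && (\dim K == k)]|.
Proof.
move=> sAJ; set C := (J :\: A)%VS.
have CA0 : (C :&: A = 0)%VS by exact: capv_diff.
have CAJ : (C + A = J)%VS by rewrite addv_diff; apply/addv_idPl.
have dimA K : (K <= C)%VS -> \dim (K + A) = (\dim K + \dim A)%N.
  move=> sKC; rewrite dimv_disjoint_sum //; apply/eqP.
  by rewrite -subv0 -CA0 capvS.
have capK K : (K <= C)%VS -> ((K + A) :&: C = K)%VS.
  by move=> sKC; rewrite -vspace_modl // (capvC A) CA0 addv0.
have addK K : (A <= K)%VS -> (K <= J)%VS -> (K :&: C + A = K)%VS.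
  by move=> sAK sKJ; rewrite vspace_modr // CAJ; apply/capv_idPl.
rewrite -[RHS](@card_in_imset _ _ (fun K => (K + A)%VS)); last first.
  move=> K K'; rewrite !inE => /andP[KC _] /andP[K'C _] eqK.
  by rewrite -(capK K) // eqK capK.
apply: eq_card => K; rewrite !inE; apply/and3P/imsetP => [[sAK sKJ /eqP dK]|].
  exists (K :&: C)%VS; last by rewrite addK.
  rewrite inE capvSr /= -(eqn_add2r (\dim A)) -dimA ?capvSr // addK // dK.
  by rewrite addnC.
case=> K'; rewrite inE => /andP[sK'C /eqP dK'] ->; split.
- exact: addvSr.
- by rewrite subv_add sAJ (subv_trans sK'C) ?diffvSl.
- by rewrite dimA // dK' addnC.
Qed.

Lemma card_nonzero_vectors J :
  (#|[set v in J | v != 0]|)%:Z = (#|F|%:Z) ^+ \dim J - 1.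
Proof.
have := card_vspace J; rewrite (cardD1 0) mem0v => cJ.
have -> : #|F|%:Z ^+ \dim J = (#|F| ^ \dim J)%N%:Z.
  by rewrite -[RHS]natz natrX natz.
rewrite -cJ PoszD addrC addKr; congr Posz.
by apply: eq_card => v; rewrite !inE andbC.
Qed.

(** Induction on [k], counting in two ways the pairs of a nonzero vector [v] and
    a [(k + 1)]-dimensional subspace through [v]: given [v], such subspaces
    correspond to the [k]-dimensional subspaces of a complement of the line of
    [v], and [gauss_absorb] is the resulting recursion. *)
Lemma card_subspaces J k :
  (#|[set K | (K <= J)%VS && (\dim K == k)]|)%:Z
  = (gauss (\dim J) k).[#|F|%:Z].
Proof.
elim: k J => [|k IHk] J.
  rewrite gaussn0 hornerC -[RHS]/(1%N : int); congr Posz.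
  rewrite -[RHS](cards1 (0%VS : {vspace 'rV[F]_n})); apply: eq_card => K.
  rewrite !inE dimv_eq0 andbC; case: eqP => //= ->; exact: sub0v.
case dJ : (\dim J) => [|j].
  rewrite [gauss _ _]/= horner0 -[RHS]/(0%N : int); congr Posz.
  apply/eqP; rewrite cards_eq0; apply/eqP/setP=> K; rewrite !inE.
  apply/negP=> /andP[/dimvS]; rewrite dJ; lia.
set S := [set K | _]; set Q := (#|F|%:Z).
have Q1 : 1 < Q by rewrite ltz_nat (finNzRing_gt1 F).
have Qk : Q ^+ k.+1 - 1 != 0.
  by rewrite subr_eq0 gt_eqF // exprn_egt1.
apply: (mulfI Qk).
transitivity (\sum_(K in S) (#|[set v in K | v != 0]|)%:Z).
  rewrite (eq_bigr (fun _ => Q ^+ k.+1 - 1)); last first.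
    move=> K; rewrite inE => /andP[_ /eqP dK].
    by rewrite card_nonzero_vectors dK.
  by rewrite sumr_const -mulr_natr natz.
transitivity (\sum_(v in [set v in J | v != 0])
    (#|[set K | [&& (<[v]> <= K)%VS, (K <= J)%VS & \dim K == (1 + k)%N]]|)%:Z).
  under eq_bigr => K _ do rewrite -sum1_card -natz natr_sum.
  under [RHS]eq_bigr => v _ do rewrite -sum1_card -natz natr_sum.
  rewrite (exchange_big_dep (mem [set v in J | v != 0])) /=; last first.
    by move=> K v; rewrite !inE => /andP[/subvP sKJ _] /andP[/sKJ-> ->].
  apply: eq_bigr => v; rewrite inE => /andP[vJ v0].
  by apply: eq_bigl => K; rewrite !inE v0 andbT -memvE andbC.
rewrite (eq_bigr (fun _ => (gauss j k).[Q])); last first.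
  move=> v; rewrite inE => /andP[vJ v0].
  have dv : \dim <[v]> = 1%N by rewrite dim_vline v0.
  have svJ : (<[v]> <= J)%VS by rewrite -memvE.
  have := card_sup_subspaces k svJ; rewrite dv => ->.
  rewrite IHk; congr (gauss _ _).[_].
  have := dimv_cap_compl J <[v]>; have /capv_idPr -> := svJ.
  by rewrite dv dJ add1n => -[].
rewrite sumr_const -mulr_natl natz card_nonzero_vectors dJ.
have := congr1 (fun P : {poly int} => P.[Q]) (gauss_absorb j k).
by rewrite !hornerE.
Qed.

End CountSubspaces.

(** * The subfield fixed by a power of the Frobenius *)

(** The [p ^ e]-power map as a morphism, for the transport of ranks, inclusions
    of row spaces and fixed points along it. *)
Lemma pow_rmorphism (R : comNzRingType) p e : p \in [pchar R] ->
  {phi : {rmorphism R -> R} | phi =1 (fun x => x ^+ (p ^ e))}.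
Proof.
move=> chRp; elim: e => [|e [phi phiE]].
  by exists idfun => x; rewrite expr1.
exists (phi \o pFrobenius_aut chRp : {rmorphism R -> R}) => x /=.
by rewrite phiE pFrobenius_autE -exprM expnS.
Qed.

Lemma pchar_pow (R : nzRingType) p e : p \in [pchar R] ->
  [pchar R].-nat (p ^ e)%N.
Proof.
move=> chRp; rewrite pnatX; apply/orP; left.
by rewrite pnatE ?(pcharf_prime chRp).
Qed.

Section ClosedSubfield.
Variables (F : finFieldType) (S : divringClosed F).

Definition closed_subfield := {x : F | x \in S}.

HB.instance Definition _ := Finite.on closed_subfield.
HB.instance Definition _ := SubChoice.on closed_subfield.
HB.instance Definition _ :=
  [SubChoice_isSubIntegralDomain of closed_subfield by <:].
HB.instance Definition _ :=
  [SubIntegralDomain_isSubField of closed_subfield by <:].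

End ClosedSubfield.

Section FixedSubfield.
Variables (F : finFieldType) (p e nu : nat).
Hypotheses (chFp : p \in [pchar F]) (cardF : #|F| = ((p ^ e) ^ nu)%N).
Let q := (p ^ e)%N.

(** ['X^q - 'X] divides ['X^#|F| - 'X], which is a product of distinct linear
    factors, so that it has as many roots in [F] as its degree. *)
Lemma card_fixed_pow : #|[pred x : F | x ^+ q == x]| = q.
Proof.
have q_gt1 : (1 < q)%N.
  have := finNzRing_gt1 F; rewrite cardF -/q.
  have : (0 < q)%N by rewrite expn_gt0 (prime_gt0 (pcharf_prime chFp)).
  by case: q => [|[|]] //; rewrite exp1n.
pose P : {poly F} := 'X^q - 'X.
have sizeP : size P = q.+1.
  by rewrite size_polyDl ?size_polyXn // size_polyN size_polyX.
have /dvdp_prod_XsubC[m Pm] : P %| \prod_(x : F) ('X - x%:P).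
  rewrite -finField_genPoly cardF -/q.
  have chP : p \in [pchar {poly F}] by rewrite pchar_poly.
  have [phi phiE] := pow_rmorphism e chP.
  elim: nu => [|k IHk]; first by rewrite expn0 expr1 subrr dvdp0.
  (* the q-power map is additive on {poly F} *)
  have -> : 'X^(q ^ k.+1) - 'X = ('X^(q ^ k) - 'X) ^+ q + P :> {poly F}.
    rewrite -[(_ - 'X) ^+ q]phiE rmorphB !phiE -exprM -expnSr.
    by rewrite /P -/q addrA subrK.
  rewrite dvdp_add ?dvdpp // (dvdp_trans IHk) // -[X in X %| _]expr1.
  by rewrite dvdp_exp2l // ltnW.
set s := mask _ _ in Pm.
have us : uniq s by rewrite mask_uniq // index_enum_uniq.
rewrite (@eq_card _ _ (mem s)) => [|x].
  rewrite (card_uniqP us); apply: succn_inj.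
  by rewrite -sizeP (eqp_size Pm) size_prod_XsubC.
rewrite !inE -root_prod_XsubC -(eqp_root Pm) rootE !hornerE.
by rewrite subr_eq0.
Qed.

(** The fixed subfield is presented as an abstract field [K] with an embedding
    [f], so that [card_subspaces] applies to it; [g] inverts [f] on its image. *)
Lemma fixed_subfield :
  exists (K : finFieldType) (f : {rmorphism K -> F}) (g : F -> K),
    [/\ #|K| = q, forall y, f y ^+ q = f y
      & forall x, x ^+ q = x -> f (g x) = x].
Proof.
have [phi phiE] := pow_rmorphism e chFp.
pose S0 := [pred x : F | x ^+ q == x].
have S0E x : (x \in S0) = (phi x == x) by rewrite phiE.
have divS0 : divring_closed S0.
  split=> [|x y|x y]; rewrite !S0E ?rmorph1 // => /eqP fx /eqP fy.
    by rewrite rmorphB fx fy.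
  by rewrite fmorph_div fx fy.
pose S : divringClosed F := HB.pack (S0 : F -> bool)
  (GRing.isDivringClosed.Build F S0 divS0).
exists (closed_subfield S : finFieldType).
exists (val : {rmorphism closed_subfield S -> F}).
exists (insubd (0 : closed_subfield S)); split=> [|y|x fx].
- by rewrite -[RHS]card_fixed_pow card_sig.
- by apply/eqP; have := valP y.
- by apply: insubdK; apply/eqP.
Qed.

End FixedSubfield.

(** * Descent of Frobenius-stable subspaces *)

(** Inclusion of subspaces becomes inclusion of the column spaces of their
    equations, which does not depend on the field over which it is tested. *)
Lemma sub_solutions (F : fieldType) n m1 m2 (B : 'M[F]_(n, m1))
    (C : 'M[F]_(n, m2)) :
  (solutions B <= solutions C)%VS = (C^T <= B^T)%MS.
Proof.
apply/idP/idP => [/subvP BC|/submxP[D /(congr1 trmx)]]; last first.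
  rewrite trmx_mul !trmxK => ->; apply/subvP=> x; rewrite !mem_solutions.
  by move=> /eqP x0; rewrite mulmxA x0 mul0mx.
have K0 : (cokermx B^T)^T *m B = 0.
  by apply: trmx_inj; rewrite trmx_mul trmxK mulmx_coker trmx0.
rewrite submxE -[_ *m _]trmxK trmx_mul trmxK trmx_eq0.
apply/eqP/row_matrixP=> i; rewrite row_mul row0; apply/eqP.
by rewrite -mem_solutions BC // mem_solutions -row_mul K0 row0.
Qed.

Lemma eq_solutions (F : fieldType) n m1 m2 (B : 'M[F]_(n, m1))
    (C : 'M[F]_(n, m2)) :
  (solutions B == solutions C) = (B^T == C^T)%MS.
Proof. by rewrite eqEsubv !sub_solutions andbC. Qed.

Definition base_change (K F : fieldType) (f : {rmorphism K -> F}) n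
    (L : {vspace 'rV[K]_n}) : {vspace 'rV[F]_n} :=
  solutions (map_mx f (equations L)).

Section BaseChange.
Variables (K F : fieldType) (f : {rmorphism K -> F}) (n : nat).
Implicit Types L : {vspace 'rV[K]_n}.

Lemma base_change_solutions m (A : 'M[K]_(n, m)) :
  base_change f (solutions A) = solutions (map_mx f A).
Proof.
apply/eqP; rewrite eq_solutions !map_trmx !map_submx.
by rewrite -eq_solutions solutions_equations.
Qed.

Lemma base_change_inj : injective (@base_change K F f n).
Proof.
move=> L L' /eqP; rewrite eq_solutions !map_trmx !map_submx.
by rewrite -eq_solutions !solutions_equations => /eqP.
Qed.

Lemma dim_base_change L : \dim (base_change f L) = \dim L.
Proof.
by rewrite dim_solutions mxrank_map -dim_solutions solutions_equations.
Qed.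

End BaseChange.

Section StableSubspaces.
Variables (F : finFieldType) (p e nu n : nat).
Hypotheses (chFp : p \in [pchar F]) (cardF : #|F| = ((p ^ e) ^ nu)%N).
Let q := (p ^ e)%N.

(** The column space of a system of equations of a stable subspace is stable.
    It has exactly one basis for which a given nonzero maximal minor is the
    identity, and the Frobenius sends this basis to another one with the same
    property, hence to itself. *)
Lemma stable_equations (L : {vspace 'rV[F]_n}) : frobV q L = L ->
  exists m (B : 'M[F]_(n, m)),
    L = solutions B /\ map_mx (fun x => x ^+ q) B = B.
Proof.
move=> stL; set A := (row_base (equations L)^T)^T.
have fullA : row_full A.
  have := row_base_free (equations L)^T.
  by rewrite /row_free -(mxrank_tr (row_base _)).
set g := fullrankfun fullA; set C := rowsub g A.
have unitC : C \in unitmx by exact: fullrowsub_unit.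
set B := A *m invmx C; have gB : rowsub g B = 1%:M.
  by rewrite -mul_rowsub_mx mulmxV.
have LB : L = solutions B.
  apply/eqP; rewrite -[X in X == _]solutions_equations eq_solutions.
  have fullC : row_full (invmx C)^T.
    by rewrite row_full_unit unitmx_tr unitmx_inv.
  apply/eqmxP; rewrite /B trmx_mul.
  apply: eqmx_trans (eqmx_sym (eqmxMfull _ fullC)).
  by rewrite trmxK; apply: eqmx_sym (eq_row_base _).
exists _, B; split=> //.
have : solutions (map_mx (fun x => x ^+ q) B) == solutions B.
  by rewrite -frobV_solutions ?pchar_pow // -LB stL.
rewrite eq_solutions => /andP[/submxP[D /(congr1 trmx)]].
rewrite trmx_mul !trmxK => BqE _.
have : rowsub g (map_mx (fun x => x ^+ q) B) = rowsub g (B *m D^T).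
  by rewrite BqE.
have [phi phiE] := pow_rmorphism e chFp.
rewrite -map_mxsub -mul_rowsub_mx gB mul1mx -(eq_map_mx _ phiE) map_mx1 => D1.
by rewrite BqE -D1 mulmx1.
Qed.

Lemma card_stable_subspaces l :
  (#|[set L : {vspace 'rV[F]_n} | (frobV q L == L) && (\dim L == l)]|)%:Z
  = (gauss n l).[q%:Z].
Proof.
have [K [f [g [cardK fK gK]]]] := fixed_subfield chFp cardF.
have := card_subspaces (fullv : {vspace 'rV[K]_n}) l.
rewrite dimvf dim_matrix mul1r cardK => <-; congr Posz.
rewrite -[RHS](card_imset _ (@base_change_inj _ _ f n)).
apply: eq_card => L; rewrite !inE.
apply/andP/imsetP=> [[/eqP stL dimL]|[L0]]; last first.
  rewrite inE subvf /= => dL0 ->; rewrite dim_base_change; split=> //.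
  rewrite frobV_solutions ?pchar_pow //; apply/eqP; congr (solutions _).
  by apply/matrixP=> i j; rewrite !mxE fK.
have [m [B [LB fixB]]] := stable_equations stL.
have LE : L = base_change f (solutions (map_mx g B)).
  rewrite base_change_solutions LB; congr (solutions _).
  apply/matrixP=> i j; rewrite !mxE gK //.
  by have := congr1 (fun M : 'M_(_, _) => M i j) fixB; rewrite mxE.
exists (solutions (map_mx g B)) => //.
by rewrite inE subvf /= -(dim_base_change f) -LE.
Qed.

End StableSubspaces.

(** * Superspaces and the Frobenius action on subspaces *)

(** The number of [k]-dimensional superspaces of an [m]-dimensional subspace of
    an [n]-dimensional space; the case split is forced by the truncation of
    [k - m], as [gauss _ 0] is 1. *)
Definition superspace_poly (n m k : nat) : {poly int} :=
  if (m <= k)%N then gauss (n - m) (k - m) else 0.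

Lemma card_superspaces (F : finFieldType) n (A : {vspace 'rV[F]_n}) k :
  (#|[set L | (A <= L)%VS && (\dim L == k)]|)%:Z
  = (superspace_poly n (\dim A) k).[#|F|%:Z].
Proof.
rewrite /superspace_poly; have [dAk|dAk] := leqP; last first.
  rewrite horner0 -[RHS]/(0%N : int); congr Posz.
  apply/eqP; rewrite cards_eq0; apply/eqP/setP=> L; rewrite !inE.
  by apply/negP=> /andP[/dimvS + /eqP dL]; rewrite dL leqNgt dAk.
have -> : (n - \dim A)%N = \dim (fullv :\: A).
  have := dimv_cap_compl fullv A.
  rewrite capfv dimvf dim_matrix mul1r => dimC.
  by rewrite -[X in (X - _)%N]dimC addKn.
rewrite -card_subspaces -card_sup_subspaces ?subvf //; congr Posz.
by apply: eq_card => L; rewrite !inE subvf subnKC.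
Qed.

Section FrobeniusAction.
Variables (F : finFieldType) (p n : nat).
Hypothesis chFp : p \in [pchar F].
Implicit Types K L M : {vspace 'rV[F]_n}.

Lemma sub_frobV e K L : (frobV (p ^ e) K <= frobV (p ^ e) L)%VS = (K <= L)%VS.
Proof.
have [phi phiE] := pow_rmorphism e chFp.
rewrite sub_solutions -!(eq_map_mx _ phiE) !map_trmx map_submx -sub_solutions.
by rewrite !solutions_equations.
Qed.

Lemma frobV_inj e : injective (@frobV F n (p ^ e)).
Proof.
move=> K L eqKL; apply/eqP.
by rewrite eqEsubv -(sub_frobV e K) -(sub_frobV e L) eqKL subvv.
Qed.

Lemma frobV_comp e d L :
  frobV (p ^ d) (frobV (p ^ e) L) = frobV (p ^ e * p ^ d) L.
Proof.
rewrite [frobV (p ^ e) L]/frobV frobV_solutions ?pchar_pow //.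
by congr (solutions _); apply/matrixP=> i j; rewrite !mxE exprM.
Qed.

End FrobeniusAction.

(** * Relative position of a subspace and its Frobenius image *)

Definition cap_count (q : nat) (F : finFieldType) (n l i : nat) : nat :=
  #|[set L : {vspace 'rV[F]_n} |
      (\dim L == l) && (\dim (L :&: frobV q L) == i)]|.

Section DoubleCount.
Variables (F : finFieldType) (p e n : nat).
Hypothesis chFp : p \in [pchar F].
Let q := (p ^ e)%N.
Implicit Types K L M : {vspace 'rV[F]_n}.
Let Q := (#|F|%:Z).

Lemma sum_by_cap (h : nat -> int) l :
  \sum_(L : {vspace 'rV[F]_n} | \dim L == l) h (\dim (L :&: frobV q L))
  = \sum_(i < l.+1) (cap_count q F n l i)%:Z * h i.
Proof.
have capl L : \dim L == l -> (\dim (L :&: frobV q L) < l.+1)%N.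
  by move=> /eqP <-; rewrite ltnS dimvS ?capvSl.
rewrite (partition_big
  (fun L => inord (\dim (L :&: frobV q L)) : 'I_l.+1) predT) //=.
apply: eq_bigr => i _.
rewrite /cap_count cardE -sum1_size -natz natr_sum mulr_suml big_enum_cond /=.
apply: eq_big => [L|L /andP[/capl lL /eqP <-]]; last by rewrite mul1r inordK.
rewrite inE /= andbT; case dL: (_ == l) => //=.
by rewrite -val_eqE /= inordK // capl.
Qed.

Lemma sum_superspaces j k :
  \sum_(L : {vspace 'rV[F]_n} | \dim L == j)
     (#|[set M | [&& (L <= M)%VS, (frobV q L <= M)%VS & \dim M == k]]|)%:Z
  = \sum_(i < j.+1)
     (cap_count q F n j i)%:Z * (superspace_poly n (2 * j - i) k).[Q].
Proof.
rewrite -(sum_by_cap (fun i => (superspace_poly n (2 * j - i) k).[Q])).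
apply: eq_bigr => L /eqP dL.
have <- : \dim (L + frobV q L) = (2 * j - \dim (L :&: frobV q L))%N.
  have := dimv_sum_cap L (frobV q L).
  by rewrite dim_frobV ?pchar_pow // dL addnn -mul2n => <-; rewrite addnK.
rewrite -card_superspaces; congr Posz.
by apply: eq_card => M; rewrite !inE subv_add andbA.
Qed.

(** Both sides count the pairs [(K, L)], with [K] of dimension [j] and [L] of
    dimension [l], such that [K <= L :&: frobV q L]; on the right [K] is written
    as the Frobenius image of some [K'], so that [L] ranges over the superspaces
    of [K' + frobV q K']. *)
Lemma cap_count_double l j :
  \sum_(i < l.+1) (cap_count q F n l i)%:Z * (gauss i j).[Q]
  = \sum_(i < j.+1)
      (cap_count q F n j i)%:Z * (superspace_poly n (2 * j - i) l).[Q].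
Proof.
rewrite -sum_superspaces -(sum_by_cap (fun i => (gauss i j).[Q])).
under eq_bigr => L _ do
  rewrite -card_subspaces -sum1_card -natz natr_sum.
under [RHS]eq_bigr => L _ do rewrite -sum1_card -natz natr_sum.
rewrite (exchange_big_dep (fun K => \dim K == j)) /=; last first.
  by move=> L K _; rewrite inE => /andP[].
rewrite (reindex_inj (frobV_inj chFp (e := e))) /=.
apply: eq_big => [K|K dK]; first by rewrite dim_frobV ?pchar_pow.
apply: eq_bigl => L.
by rewrite !inE subv_cap sub_frobV // dK andbT andbC andbCA andbA.
Qed.

End DoubleCount.

(** * Polynomiality of the counts *)

Section Polynomiality.
Variable q : nat.

(** One polynomial has to serve for all the fields whose cardinal is a power of
    [q], while its coefficients may depend on [q]. *)
Definition polynomial_in_card (h : finFieldType -> int) : Prop :=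
  exists N : {poly int}, forall (F : finFieldType) (nu : nat),
    #|F| = (q ^ nu)%N -> h F = N.[#|F|%:Z].

Lemma eq_polynomial_in_card h h' :
    (forall (F : finFieldType) nu, #|F| = (q ^ nu)%N -> h F = h' F) ->
  polynomial_in_card h' -> polynomial_in_card h.
Proof.
by move=> eqh [N NP]; exists N => F nu cF; rewrite (eqh F nu) ?(NP F nu).
Qed.

Lemma polynomial_in_card_const c : polynomial_in_card (fun=> c).
Proof. by exists c%:P => F nu _; rewrite hornerC. Qed.

Lemma polynomial_in_cardB h h' : polynomial_in_card h ->
  polynomial_in_card h' -> polynomial_in_card (fun F => h F - h' F).
Proof.
move=> [N NP] [N' NP']; exists (N - N') => F nu cF.
by rewrite !hornerE (NP F nu) ?(NP' F nu).
Qed.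

Lemma polynomial_in_card_mulr h (P : {poly int}) : polynomial_in_card h ->
  polynomial_in_card (fun F => h F * P.[#|F|%:Z]).
Proof.
by move=> [N NP]; exists (N * P) => F nu cF; rewrite !hornerE (NP F nu).
Qed.

Lemma polynomial_in_card_sum (I : Type) (s : seq I) (A : pred I) h :
    (forall i, A i -> polynomial_in_card (h i)) ->
  polynomial_in_card (fun F => \sum_(i <- s | A i) h i F).
Proof.
move=> hP; elim: s => [|i s [N NP]].
  by exists 0 => F nu _; rewrite big_nil horner0.
case Ai: (A i); last by exists N => F nu cF; rewrite big_cons Ai (NP F nu).
have [N' NP'] := hP i Ai; exists (N' + N) => F nu cF.
by rewrite big_cons Ai !hornerE (NP F nu) ?(NP' F nu).
Qed.

End Polynomiality.

Section CapCountPolynomial.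
Variables (p e n : nat).
Hypothesis p_prime : prime p.
Let q := (p ^ e)%N.

Lemma pchar_of_card (F : finFieldType) nu : #|F| = (q ^ nu)%N -> p \in [pchar F].
Proof. by rewrite /q -expnM => /card_finPcharP; apply. Qed.

(** Induction on [l], then downwards on [i].  For [i = l] the subspaces counted
    are the stable ones; for [i < l], [cap_count_double] expresses
    [cap_count q F n l i], whose coefficient there is [gauss i i = 1], by the
    counts with smaller [l] and by those with the same [l] and larger [i]. *)
Lemma polynomial_cap_count l i :
  polynomial_in_card q (fun F => (cap_count q F n l i)%:Z).
Proof.
elim/ltn_ind: l i => l IHl i.
have [d] := ubnP (l - i)%N; elim: d i => // d IHd i /[!ltnS] led.
have [il|il|->] := ltngtP i l; last 1 first.
- apply: eq_polynomial_in_card (polynomial_in_card_const q (gauss n l).[q%:Z]).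
  move=> F nu cF; have chFp := pchar_of_card cF.
  rewrite -(card_stable_subspaces n chFp cF); congr Posz.
  apply: eq_card => L; rewrite !inE.
  case: (\dim L =P l) => [dL|_]; last by rewrite andbF.
  rewrite andTb andbT -[X in _ == X]dL.
  rewrite (dimv_leqif_eq (capvSl _ _)).
  rewrite (sameP eqP capv_idPl) eq_sym eqEdim dim_frobV ?leqnn ?andbT //.
  exact: pchar_pow.
- have il1 : (i < l.+1)%N by exact: ltnW.
  pose pairs (F : finFieldType) := \sum_(k < i.+1)
    (cap_count q F n i k)%:Z * (superspace_poly n (2 * i - k) l).[#|F|%:Z].
  pose others (F : finFieldType) := \sum_(k < l.+1 | k != Ordinal il1)
    (cap_count q F n l k)%:Z * (gauss k i).[#|F|%:Z].
  apply: (@eq_polynomial_in_card _ _ (fun F => pairs F - others F)).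
    move=> F nu cF; have := cap_count_double e n (pchar_of_card cF) l i.
    rewrite (bigD1 (Ordinal il1)) //= gaussnn hornerC mulr1.
    exact: (canRL (addrK _)).
  apply: polynomial_in_cardB.
  + apply: polynomial_in_card_sum => k _.
    by apply: polynomial_in_card_mulr; apply: IHl.
  apply: polynomial_in_card_sum => k ki.
  have [lki|] := ltnP k i.
    apply: eq_polynomial_in_card (polynomial_in_card_const q 0) => F nu _.
    by rewrite gauss_small // horner0 mulr0.
  rewrite leq_eqVlt => /orP[/eqP ik|ik].
    by case/eqP: ki; apply: val_inj.
  apply/polynomial_in_card_mulr/IHd; have := ltn_ord k; lia.
- apply: eq_polynomial_in_card (polynomial_in_card_const q 0) => F nu _.
  rewrite -[RHS]/(0%N : int); congr Posz; apply/eqP; rewrite cards_eq0.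
  apply/eqP/setP=> L; rewrite !inE; apply/negP=> /andP[/eqP dL /eqP dC].
  by have := dimvS (capvSl L (frobV q L)); rewrite dL dC leqNgt il.
Qed.

End CapCountPolynomial.

Theorem theorem1p3 (p n l c a b r s : nat)
    (p_prime : prime p) (n_ge3 : (3 <= n)%N)
    (l_gt0 : (0 < l)%N) (c_gt0 : (0 < c)%N) (lc_ltn : (l + c < n)%N)
    (rE : r = (p ^ a)%N) (sE : s = (p ^ b)%N)
    (rs_gt1 : (1 < r)%N \/ (1 < s)%N) :
  exists N : {poly int}, forall nu : nat, (1 <= nu)%N ->
    forall F : finFieldType, #|F| = ((r * s) ^ nu)%N ->
      (#|@frob_incidence F n r s l c|)%:Z = N.[((r * s) ^ nu)%N%:Z].
Proof.
have rsE : (r * s = p ^ (a + b))%N by rewrite rE sE expnD.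
have [N NP] : polynomial_in_card (r * s) (fun F => \sum_(i < l.+1)
    (cap_count (r * s) F n l i)%:Z
    * (superspace_poly n (2 * l - i) (n - c)).[#|F|%:Z]).
  apply: polynomial_in_card_sum => i _; apply: polynomial_in_card_mulr.
  by rewrite rsE; apply: polynomial_cap_count.
exists N => nu _ F cF; rewrite -cF -(NP F nu cF) rsE.
have chFp : p \in [pchar F].
  by apply: (@pchar_of_card p (a + b) _ _ nu); rewrite -?rsE.
rewrite -sum_superspaces // -sum1_card -natz natr_sum.
pose T := {vspace 'rV[F]_n}.
pose over (L M : T) :=
  [&& (L <= frobV s M)%VS, (frobV r L <= M)%VS & \dim M == (n - c)%N].
transitivity (\sum_(LM : T * T | (\dim LM.1 == l) && over LM.1 LM.2) 1%R : int).
  apply: eq_bigl => -[L M]; rewrite !inE /= /over; congr (_ && _).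
  have -> : (\dim M + c == n)%N = (\dim M == n - c)%N by lia.
  by rewrite andbC -andbA andbCA.
rewrite -(pair_big_dep (fun L : T => \dim L == l) over (fun _ _ => 1)) /=.
apply: eq_bigr => L _; rewrite -sum1_card -natz natr_sum.
(* the summation index on the right becomes the image of M *)
rewrite [RHS](reindex_inj (frobV_inj chFp (e := b))) /=.
apply: eq_bigl => M; rewrite inE dim_frobV ?pchar_pow //.
by rewrite expnD -frobV_comp // sub_frobV // -rE -sE.
Qed.
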